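(* For all $m,n\ge0$, the space $W_{m,n}$ is spanned by the vectors $$v_{\alpha,\beta}=\prod_{j=1}^m\bar e_{\alpha_j+2(m-j)+1-n}\prod_{j=1}^n\bar f_{\beta_j+2(n-j)+1}\,\bar v,$$ where $\alpha=(\alpha_1\ge\cdots\ge\alpha_m\ge0)$ and $\beta=(\beta_1\ge\cdots\ge\beta_n\ge0)$ range over sequences of nonnegative integers.
   Context: Let $\mathcal H$ be the Lie algebra with basis $\bar e_i,\bar h_i,\bar f_i$ ($i\in\mathbb Z$), brackets $[\bar e_i,\bar f_j]=\bar h_{i+j}$ and all other brackets of basis elements zero. Let $\mathcal H^-$ be spanned by basis elements of index $\le0$, and $M_{\mathcal H}=U(\mathcal H)\otimes_{U(\mathcal H^-)}\mathbb C\bar v$ induced from the trivial one-dimensional $\mathcal H^-$-module. With $\bar e(z)=\sum_i\bar e_iz^i$, etc., $W$ is the quotient of $M_{\mathcal H}$ by the span of all $z$-coefficients of $\bar e(z)^2u,\bar f(z)^2u,\bar e(z)\bar h(z)u,\bar f(z)\bar h(z)u,\bar h(z)^2u$, $u\in M_{\mathcal H}$ (we write $\bar v$ also for its image). $W$ is $\mathbb Z^3$-graded by $\deg\bar v=(0,0,0)$, $\deg\bar e_i=(1,0,i)$, $\deg\bar h_i=(1,1,i)$, $\deg\bar f_i=(0,1,i)$; $W_{m,n}$ is the sum of the components whose first two degrees are $(m,n)$. *)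

(* Defs.v *)
From HB Require Import structures.
From mathcomp Require Import all_boot all_algebra.
From mathcomp Require Import finmap.
From mathcomp Require Import complex.
From mathcomp Require Import Rstruct.
From mathcomp.multinomials Require Import monalg.
From Stdlib Require Import Reals.

Set Implicit Arguments.
Unset Strict Implicit.
Unset Printing Implicit Defensive.

Import GRing.Theory.
Local Open Scope ring_scope.

(* Basis letters of the Lie algebra H: e_i, h_i, f_i (i : int). *)
Inductive letter := LE of int | LH of int | LF of int.

Definition letter_code (x : letter) : int + int + int :=
  match x with LE i => inl (inl i) | LH i => inl (inr i) | LF i => inr i end.
Definition letter_decode (c : int + int + int) : letter :=
  match c with inl (inl i) => LE i | inl (inr i) => LH i | inr i => LF i end.
Lemma letter_codeK : cancel letter_code letter_decode.
Proof. by case. Qed.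
HB.instance Definition _ := Countable.copy letter (can_type letter_codeK).

Definition lidx (x : letter) : int :=
  match x with LE i => i | LH i => i | LF i => i end.

(* A word [:: x1; ...; xk] stands for x1 x2 ... xk applied to vbar. *)
Definition word := seq letter.

Definition C : fieldType := (Rdefinitions.R)[i].

(* T = tensor algebra of H applied to vbar (free vector space on words);
   M_H and W are quotients of T. *)
Definition T := {malg C[word]}.

Definition wvec (w : word) : T := << w >>.

Definition mulw (a : word) (x : T) : T :=
  \sum_(w <- msupp x) << x@_w *g (a ++ w) >>.

Inductive span_of (P : T -> Prop) : T -> Prop :=
| span0 : span_of P 0
| spanD x y : span_of P x -> span_of P y -> span_of P (x + y)
| spanZ (c : C) x : span_of P x -> span_of P (c *: x)
| span_gen x : P x -> span_of P x.

Definition bracket_term (a b : word) (x y : letter) : T :=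
  match x, y with
  | LE i, LF j => wvec (a ++ LH (i + j) :: b)
  | LF j, LE i => - wvec (a ++ LH (i + j) :: b)
  | _, _ => 0
  end.

(* Generators of the kernel of T ->> M_H = U(H) (x)_{U(H^-)} C vbar:
   the two-sided ideal of PBW relations xy - yx - [x,y], and the left ideal
   generated by H^- (letters of index <= 0 acting first on vbar). *)
Definition MH_gen (t : T) : Prop :=
  (exists (a b : word) (x y : letter),
      t = wvec (a ++ x :: y :: b) - wvec (a ++ y :: x :: b) - bracket_term a b x y)
  \/ (exists (a : word) (l : letter), (lidx l <= 0) /\ t = wvec (rcons a l)).

Definition zero_in_MH (t : T) : Prop := span_of MH_gen t.

(* The pairs of fields (X,Y) whose products X(z)Y(z) are imposed:
   e e, f f, e h, f h, h h. *)
Definition field_pairs : seq ((int -> letter) * (int -> letter)) :=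
  [:: (LE, LE); (LF, LF); (LE, LH); (LF, LH); (LH, LH)].

(* The z^k coefficient of X(z)Y(z)u, i.e. sum_{i+j=k} X_i Y_j u, which is a
   finite sum in M_H: t is that coefficient (up to elements zero in M_H) when
   S is a duplicate-free list of indices outside of which all terms vanish
   in M_H. *)
Definition W_rel (t : T) : Prop :=
  exists (X Y : int -> letter) (u : T) (k : int) (S : seq int),
    [/\ List.In (X, Y) field_pairs,
        uniq S,
        (forall i, i \notin S -> zero_in_MH (mulw [:: X i; Y (k - i)] u)) &
        t = \sum_(i <- S) mulw [:: X i; Y (k - i)] u].

Definition zero_in_W (t : T) : Prop :=
  span_of (fun s => MH_gen s \/ W_rel s) t.

Definition ldeg (x : letter) : nat * nat :=
  match x with LE _ => (1%N, 0%N) | LH _ => (1%N, 1%N) | LF _ => (0%N, 1%N) end.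
Definition bideg (w : word) : nat * nat :=
  foldr (fun x d => ((ldeg x).1 + d.1, (ldeg x).2 + d.2)%N) (0%N, 0%N) w.

Definition homog (m n : nat) (t : T) : Prop :=
  forall w, w \in msupp t -> bideg w = (m, n).

Definition partition_of (m : nat) (al : seq nat) : Prop :=
  size al = m /\ sorted geq al.

(* the word of v_{alpha,beta}; index j (0-based) corresponds to j+1 *)
Definition vword (m n : nat) (al be : seq nat) : word :=
  [seq LE ((nth 0%N al j)%:Z + 2 * Posz (subn m j.+1) + 1 - n%:Z) | j <- iota 0 m]
  ++ [seq LF ((nth 0%N be j)%:Z + 2 * Posz (subn n j.+1) + 1) | j <- iota 0 n].

Definition v_ab (m n : nat) (al be : seq nat) : T := wvec (vword m n al be).

(* Main.v *)
(* M_H is the quotient of the tensor algebra by [zero_in_MH]; W is handled as M_H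
   modulo the subgroup [W0]. For i << 0 the letter e_i kills a given vector u, so
   h_k u = e_i f_{k-i} u; hence M_H is spanned by the vectors e_I f_J v. Such a
   vector vanishes as soon as some entry of J is <= 0. Multiplying
   e(x) f(y_1)...f(y_n) v by prod_b (x - y_b) kills all commutators [e(x), f(y_b)],
   so only positive powers of x survive; this rewrites e_i f_J v with i <= -n in
   terms of vectors e_i' f_J' v with sum J' < sum J. Finally e(z)^2 = 0 and
   f(z)^2 = 0 replace two entries differing by at most 1 by more distant pairs with
   the same sum. The induction is on sum J, and then on the (bounded) sums of
   squares of the entries of J and of I. *)

Require Import Defs.
From HB Require Import structures.
From mathcomp Require Import all_boot all_order all_algebra.
From mathcomp Require Import finmap complex Rstruct boolp zify ring.
From mathcomp.multinomials Require Import monalg.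

Import GRing.Theory Num.Theory Order.TTheory.
Local Open Scope ring_scope.

Set Implicit Arguments.
Unset Strict Implicit.

(** * Sums with finite support *)

Definition fsum (I : eqType) (V : zmodType) (g : I -> V) (s : V) : Prop :=
  exists S : seq I,
    [/\ uniq S, forall i, i \notin S -> g i = 0 & s = \sum_(i <- S) g i].

Section FinitelySupportedSum.

Variables (I : eqType) (V W : zmodType).

Lemma sum_support (g : I -> V) (S S' : seq I) :
  uniq S -> uniq S' ->
  (forall i, i \notin S -> g i = 0) -> (forall i, i \notin S' -> g i = 0) ->
  \sum_(i <- S) g i = \sum_(i <- S') g i.
Proof.
have aux (A B : seq I) : (forall i, i \notin B -> g i = 0) ->
    \sum_(i <- A) g i = \sum_(i <- [seq x <- A | x \in B]) g i.
  move=> gB; rewrite big_filter [LHS](bigID (mem B)) /=.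
  by rewrite [X in _ + X]big1 ?addr0 // => i /gB.
move=> uS uS' gS gS'; rewrite (aux S S' gS') (aux S' S gS).
apply: perm_big; apply: uniq_perm; rewrite ?filter_uniq // => i.
by rewrite !mem_filter andbC.
Qed.

Lemma fsum_on (D : seq I) (g : I -> V) s : fsum g s ->
  exists S : seq I, [/\ uniq S, {subset D <= S},
    forall i, i \notin S -> g i = 0 & s = \sum_(i <- S) g i].
Proof.
case=> S [uS gS ->]; exists (undup (D ++ S)).
have gDS i : i \notin undup (D ++ S) -> g i = 0.
  by rewrite mem_undup mem_cat negb_or => /andP[_ /gS].
split=> //; first exact: undup_uniq.
  by move=> i iD; rewrite mem_undup mem_cat iD.
by apply: sum_support; rewrite ?undup_uniq.
Qed.

(** This makes the relation [fsum] a partial function, defined exactly where the support is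
    finite. *)
Lemma fsum_uniq (g : I -> V) s s' : fsum g s -> fsum g s' -> s = s'.
Proof.
case=> S [uS gS ->] [S' [uS' gS' ->]]; exact: sum_support.
Qed.

Lemma eq_fsum (g g' : I -> V) s : g =1 g' -> fsum g s -> fsum g' s.
Proof. by move=> /funext ->. Qed.

Lemma fsumD (g g' : I -> V) s s' :
  fsum g s -> fsum g' s' -> fsum (fun i => g i + g' i) (s + s').
Proof.
move=> /[dup] gs [S [uS gS _]] /(fsum_on S)[S' [uS' SS' gS' ->]].
exists S'; split=> // [i iS'|].
  by rewrite gS' // gS ?addr0 //; apply: contraNN iS'; apply: SS'.
rewrite big_split /=; congr (_ + _).
apply: (fsum_uniq gs); exists S'; split=> // i iS'.
by rewrite gS //; apply: contraNN iS'; apply: SS'.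
Qed.

Lemma fsum_raddf (f : {additive V -> W}) (g : I -> V) s :
  fsum g s -> fsum (fun i => f (g i)) (f s).
Proof.
case=> S [uS gS ->]; exists S; split=> // [i /gS -> |]; first exact: raddf0.
exact: raddf_sum.
Qed.

Lemma fsum_reindex (h h' : I -> I) (g : I -> V) s :
  cancel h h' -> cancel h' h -> fsum g s -> fsum (fun i => g (h i)) s.
Proof.
move=> hK h'K [S [uS gS ->]]; exists (map h' S); split.
- by rewrite map_inj_uniq //; apply: can_inj h'K.
- move=> i iS; apply: gS; apply: contraNN iS => iS.
  by apply/mapP; exists (h i); rewrite ?hK.
- by rewrite big_map; apply: eq_bigr => i _; rewrite h'K.
Qed.

End FinitelySupportedSum.

(** * Additive subgroups and symmetric sums *)

Definition subgroup (V : zmodType) (Q : V -> Prop) : Prop :=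
  Q 0 /\ forall x y, Q x -> Q y -> Q (x - y).

Section Subgroup.

Variables (V : zmodType) (Q : V -> Prop).
Hypothesis subQ : subgroup Q.

Lemma subgroup0 : Q 0. Proof. by case: subQ. Qed.

Lemma subgroupB x y : Q x -> Q y -> Q (x - y).
Proof. by case: subQ => _; apply. Qed.

Lemma subgroupN x : Q x -> Q (- x).
Proof. by move=> Qx; rewrite -sub0r; apply: subgroupB => //; apply: subgroup0. Qed.

Lemma subgroupD x y : Q x -> Q y -> Q (x + y).
Proof. by move=> Qx Qy; rewrite -[y]opprK; apply: subgroupB => //; apply: subgroupN. Qed.

Lemma subgroup_sum (I : Type) (r : seq I) (P : pred I) (F : I -> V) :
  (forall i, P i -> Q (F i)) -> Q (\sum_(i <- r | P i) F i).
Proof.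
move=> QF; apply: (big_ind Q) => //; first exact: subgroup0.
exact: subgroupD.
Qed.

Lemma subgroup_preim (U : zmodType) (f : {additive U -> V}) :
  subgroup (fun x => Q (f x)).
Proof.
split=> [|x y Qx Qy]; first by rewrite raddf0; apply: subgroup0.
by rewrite raddfB; apply: subgroupB.
Qed.

(** The terms at [p] and [k - p] coincide. Removing all other terms leaves [g p] if [k = 2p], and
    [g p + g p] otherwise. *)
Lemma fsum_pair (g : int -> V) (k p : int) s :
  (forall x, Q (x + x) -> Q x) -> (forall i, g (k - i) = g i) ->
  fsum g s -> Q s -> (forall i, i != p -> i != k - p -> Q (g i)) ->
  Q (g p).
Proof.
move=> half gsym /(fsum_on [:: p; k - p])[S [uS DS _ ->]] Qs Qg.
have pS : p \in S by apply: DS; rewrite inE eqxx.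
have qS : k - p \in S by apply: DS; rewrite !inE eqxx orbT.
move: Qs; rewrite (bigD1_seq p) //=.
have [eqp|nep] := eqVneq (k - p) p.
  set r := \sum_(i <- S | _) _ => Qs; rewrite -(addrK r (g p)).
  apply: subgroupB => //; apply: subgroup_sum => i ip.
  by apply: Qg; rewrite ?eqp.
rewrite -big_filter (bigD1_seq (k - p)) ?mem_filter ?nep ?filter_uniq //= gsym.
rewrite addrA; set r := \sum_(i <- _ | _) _ => Qs.
apply: half; rewrite -(addrK r (g p + g p)); apply: subgroupB => //.
rewrite /r big_filter_cond; apply: subgroup_sum => i /andP[ip iq].
exact: Qg.
Qed.

End Subgroup.

(** * Spreading close entries of integer sequences *)

Definition gap2 : rel int := fun x y => y + 2 <= x.

Lemma gap2_split (s : seq int) : sorted >=%R s -> sorted gap2 s \/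
  exists s1 x y s2, s = s1 ++ x :: y :: s2 /\ y <= x <= y + 1.
Proof.
elim: s => [|x [|y s] IHs]; [by left|by left|].
move=> /= /andP[yx /IHs[gs|[s1 [x' [y' [s2 [-> xy']]]]]]]; last first.
  by right; exists (x :: s1), x', y', s2.
have [xy|xy] := lerP x (y + 1); first by right; exists [::], x, y, s; rewrite yx.
by left; apply/andP; split=> //; rewrite /gap2; lia.
Qed.

(* Replacing a pair [(p, k - p)] of almost equal entries by a more distant pair
   with the same sum increases the sum of squares, which is bounded as long as
   the entries stay [>= b]. *)
Lemma spread_ind (P : seq int -> Prop) (b : int) (n : nat) :
  (forall s t : seq int, perm_eq s t -> P s -> P t) ->
  (forall s : seq int, size s = n -> has (fun x => x < b) s -> P s) ->
  (forall (p k : int) s, (size s).+2 = n -> p <= k - p <= p + 1 ->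
     (forall i : int, i < p -> P (i :: k - i :: s)) -> P (p :: k - p :: s)) ->
  (forall s, size s = n -> sorted gap2 s -> all (fun x => b <= x) s -> P s) ->
  forall s, size s = n -> P s.
Proof.
move=> Pperm Plow Pspread Padm.
pose tot (s : seq int) := (\sum_(x <- s) absz (x - b))%N.
pose sq (s : seq int) := (\sum_(x <- s) absz (x - b) ^ 2)%N.
have sq_le s : (sq s <= tot s ^ 2)%N.
  rewrite /sq /tot; elim: s => [|x s IHs]; first by rewrite !big_nil.
  by rewrite !big_cons sqrnD -addnA leq_add2l; apply: leq_trans IHs (leq_addr _ _).
(* While all entries are [>= b], spreading fixes [tot] and increases [sq], so [tot ^ 2 - sq]
   decreases; [sq_le] keeps the subtraction from truncating. *)
suff main N s : (tot s ^ 2 - sq s < N)%N -> size s = n -> P s.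
  by move=> s; apply: main (ltnSn _).
elim: N s => [|N IHN] s sN szs; first by lia.
have [|sb] := boolP (has (fun x => x < b) s); first exact: Plow.
have ps : perm_eq (sort >=%R s) s by rewrite perm_sort.
have tt (t : seq int) : perm_eq t s -> tot t = tot s by move=> ts; apply: perm_big.
have sqt (t : seq int) : perm_eq t s -> sq t = sq s by move=> ts; apply: perm_big.
have geb (t : seq int) : perm_eq t s -> all (fun x => b <= x) t.
  move=> /perm_mem ts; apply/allP => x; rewrite ts => xs.
  by rewrite leNgt; apply: contraNN sb => xb; apply/hasP; exists x.
have [|gs|[s1 [x [y [s2 [sE yx]]]]]] := @gap2_split (sort >=%R s).
- by apply: sort_sorted => x y; apply: le_total.
- by apply: (Pperm _ _ ps); apply: Padm; rewrite ?size_sort ?geb.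
have pyx : perm_eq (y :: x :: s1 ++ s2) s.
  by apply/permP => a; rewrite -(permP ps) sE /= !count_cat /=; lia.
apply: (Pperm _ _ pyx).
have xk : x = (x + y) - y by rewrite addrK.
rewrite [in y :: x :: _]xk; apply: Pspread; rewrite -?xk //.
  by rewrite -szs -(perm_size pyx).
move=> i iy.
have szi : size (i :: x + y - i :: s1 ++ s2) = n by rewrite -szs -(perm_size pyx).
have [ib|ib] := ltP i b; first by apply: Plow; rewrite //= ib.
apply: IHN szi.
have := geb _ pyx => /= /and3P[yb xb _].
have := sq_le (i :: x + y - i :: s1 ++ s2).
move: sN; rewrite -(tt _ pyx) -(sqt _ pyx) /tot /sq !big_cons.
set T := (\sum_(_ <- _) _)%N; set S := (\sum_(_ <- _) _ ^ 2)%N.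
(* Relative to [b], the old pair is [a + d, a + d + c] and the new one [a, a + c + 2d] with [d > 0].
   The sum of squares grows by [2d(d + c)]. *)
have [d dE] : exists d : nat, y = (i + d%:Z)%R by exists (absz (y - i)%R); lia.
have [a aE] : exists a : nat, i = (b + a%:Z)%R by exists (absz (i - b)%R); lia.
have [c cE] : exists c : nat, x = (y + c%:Z)%R by exists (absz (x - y)%R); lia.
have -> : absz (i - b) = a by lia.
have -> : absz (y - b) = (a + d)%N by lia.
have -> : absz (x - b) = (a + c + d)%N by lia.
have -> : absz (x + y - i - b)%R = (a + c + 2 * d)%N by lia.
have -> : (a + (a + c + 2 * d + T) = a + d + (a + c + d + T))%N by lia.
have : ((a + d) ^ 2 + (a + c + d) ^ 2 + 2 * d * (d + c)
        = a ^ 2 + (a + c + 2 * d) ^ 2)%N by ring.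
have : (0 < 2 * d * (d + c))%N by rewrite !muln_gt0 addn_gt0; lia.
move: (2 * d * (d + c))%N => r.
move: ((a + d) ^ 2)%N ((a + c + d) ^ 2)%N (a ^ 2)%N ((a + c + 2 * d) ^ 2)%N (_ ^ 2)%N.
lia.
Qed.

Lemma foldr_perm (X : eqType) (A : Type) (op : X -> A -> A) (z : A) (s t : seq X) :
  (forall x y a, op x (op y a) = op y (op x a)) ->
  perm_eq s t -> foldr op z s = foldr op z t.
Proof.
move=> opC; have rem_out x r : x \in r -> foldr op z r = op x (foldr op z (rem x r)).
  elim: r => //= y r IHr; rewrite inE eq_sym; case: eqP => [-> //|_ /= xr].
  by rewrite IHr // opC.
elim: s t => [|x s IHs] t; first by rewrite perm_sym => /perm_nilP ->.
move=> st; have xt : x \in t by rewrite -(perm_mem st) mem_head.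
rewrite [RHS](rem_out x) //= (IHs (rem x t)) //.
by rewrite -(perm_cons x) (perm_trans st) // perm_to_rem.
Qed.

(** * Operators of the Lie algebra on an abstract induced module *)

Definition bracket_op (V : zmodType) (op : letter -> {additive V -> V})
    (x y : letter) (u : V) : V :=
  match x, y with
  | LE i, LF j => op (LH (i + j)) u
  | LF j, LE i => - op (LH (i + j)) u
  | _, _ => 0
  end.

Section InducedModule.

Variables (V : zmodType) (op : letter -> {additive V -> V}) (v : V).
Hypothesis opC : forall x y u, op x (op y u) = op y (op x u) + bracket_op op x y u.
Hypothesis op_vac : forall l, lidx l <= 0 -> op l v = 0.

Notation e i := (op (LE i)).
Notation f i := (op (LF i)).
Notation h i := (op (LH i)).

Definition act (w : word) : V := foldr (fun l => op l) v w.
Definition Eact (I : seq int) (u : V) : V := foldr (fun i => op (LE i)) u I.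
Definition Fact (J : seq int) (u : V) : V := foldr (fun j => op (LF j)) u J.

Lemma eC i j u : e i (e j u) = e j (e i u). Proof. by rewrite opC addr0. Qed.
Lemma fC i j u : f i (f j u) = f j (f i u). Proof. by rewrite opC addr0. Qed.
Lemma heC i j u : h i (e j u) = e j (h i u). Proof. by rewrite opC addr0. Qed.
Lemma hfC i j u : h i (f j u) = f j (h i u). Proof. by rewrite opC addr0. Qed.
Lemma hC i j u : h i (h j u) = h j (h i u). Proof. by rewrite opC addr0. Qed.
Lemma efC i j u : e i (f j u) = f j (e i u) + h (i + j) u.
Proof. by rewrite opC. Qed.

Lemma Eact_cat I J u : Eact (I ++ J) u = Eact I (Eact J u).
Proof. exact: foldr_cat. Qed.

Lemma Eact_perm I J u : perm_eq I J -> Eact I u = Eact J u.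
Proof. by apply: foldr_perm => i j x; rewrite eC. Qed.
Lemma Fact_perm I J u : perm_eq I J -> Fact I u = Fact J u.
Proof. by apply: foldr_perm => i j x; rewrite fC. Qed.

Lemma eEact i I u : e i (Eact I u) = Eact I (e i u).
Proof. by elim: I => //= j I <-; rewrite eC. Qed.
Lemma hEact i I u : h i (Eact I u) = Eact I (h i u).
Proof. by elim: I => //= j I <-; rewrite heC. Qed.
Lemma fFact i I u : f i (Fact I u) = Fact I (f i u).
Proof. by elim: I => //= j I <-; rewrite fC. Qed.

Lemma Eact_additive I : exists g : {additive V -> V}, Eact I =1 g.
Proof.
elim: I => [|i I [g gE]]; first by exists idfun.
by exists (e i \o g) => u /=; rewrite gE.
Qed.

Lemma Eact0 I : Eact I 0 = 0.
Proof. by have [g ->] := Eact_additive I; apply: raddf0. Qed.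

Lemma act_EF I J : act ([seq LE i | i <- I] ++ [seq LF j | j <- J])
  = Eact I (Fact J v).
Proof. by rewrite /act foldr_cat !foldr_map. Qed.

Lemma Fact_vac j J : j \in J -> j <= 0 -> Fact J v = 0.
Proof.
move=> jJ j0; rewrite (Fact_perm _ (perm_to_rem jJ)) /= fFact op_vac //.
by elim: (rem j J) => //= i K ->; rewrite raddf0.
Qed.

(** Moving [l] past the first letter [x] of a word costs only a bracket of index [lidx l + lidx x],
    so the bound grows by at most the absolute value of [lidx x]. *)
Lemma act_locally_nilpotent w :
  exists N : nat, forall l, lidx l <= - N%:Z -> op l (act w) = 0.
Proof.
elim: w => [|x w [N Nw]]; first by exists 0%N => l; rewrite oppr0; apply: op_vac.
exists (N + absz (lidx x))%N => l lN /=; rewrite opC Nw ?raddf0 ?add0r; last lia.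
by case: x l lN => i [] j //= lN; rewrite ?Nw ?oppr0 //=; lia.
Qed.

Definition commuting (X Y : int -> letter) : Prop :=
  forall i j u, op (X i) (op (Y j) u) = op (Y j) (op (X i) u).

(** For very negative [i] the factor [X i] can be moved inside and kills; for large [i] the factor
    [Y (k - i)] kills. *)
Lemma fsum_field (X Y : int -> letter) w k :
  (forall i, lidx (X i) = i) -> (forall i, lidx (Y i) = i) -> commuting X Y ->
  exists s, fsum (fun i => op (X i) (op (Y (k - i)) (act w))) s.
Proof.
move=> Xi Yi XY; have [N Nw] := act_locally_nilpotent w.
pose S := [seq (Posz n - N%:Z) | n <- iota 0 (N + N + absz k)].
exists (\sum_(i <- S) op (X i) (op (Y (k - i)) (act w))); exists S; split=> //.
  by rewrite map_inj_uniq ?iota_uniq // => a b; lia.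
move=> i iS; have [iN|iN] := leP i (- N%:Z).
  by rewrite XY Nw ?raddf0 // Xi.
rewrite Nw ?raddf0 // Yi; apply: contraNT iS => kiN.
apply/mapP; exists (absz (i + N%:Z)); last by lia.
by rewrite mem_iota; lia.
Qed.

(** * Spanning by products of e's followed by f's *)

Lemma lead_h k w : exists i, h k (act w) = e i (f (k - i) (act w)).
Proof.
have [N Nw] := act_locally_nilpotent w.
by exists (- N%:Z); rewrite efC (Nw (LE _)) // raddf0 add0r addrC subrK.
Qed.

(** Since [h k] commutes with the e's, it is replaced by [e i] and [f (k - i)] right in front of the
    f's, where the new [f] is already in place. *)
Lemma h_span k I J (Q : V -> Prop) :
  (forall I' J', size I' = (size I).+1 -> size J' = (size J).+1 ->
     Q (Eact I' (Fact J' v))) ->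
  Q (h k (Eact I (Fact J v))).
Proof.
move=> QEF; rewrite hEact; have := act_EF [::] J; rewrite /= => <-.
have [i ->] := lead_h k [seq LF j | j <- J].
have /= := act_EF [::] J => ->; rewrite -eEact.
exact: (QEF (i :: I) (k - i :: J)).
Qed.

Lemma f_span j I J (Q : V -> Prop) : subgroup Q ->
  (forall I' J', size I' = size I -> size J' = (size J).+1 ->
     Q (Eact I' (Fact J' v))) ->
  Q (f j (Eact I (Fact J v))).
Proof.
elim: I Q => [|i I IHI] Q subQ QEF; first exact: (QEF [::] (j :: J)).
(* The bracket trades [e i] and [f j] for one [h], and [h_span] restores both letters. *)
rewrite /= opC /=; apply: subgroupB => //; last exact: h_span.
apply: (IHI (fun x => Q (e i x))); first exact: subgroup_preim.
by move=> I' J' sI sJ; apply: (QEF (i :: I')) => //=; rewrite sI.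
Qed.

(** Induction on the word, replacing [Q] by its preimage under the first letter. *)
Lemma act_span (Q : V -> Prop) w m n : subgroup Q ->
  (forall I J, size I = m -> size J = n -> Q (Eact I (Fact J v))) ->
  bideg w = (m, n) -> Q (act w).
Proof.
elim: w Q m n => [|x w IHw] Q m n subQ QEF /=.
  by case=> m0 n0; apply: (QEF [::] [::]).
have subQx := subgroup_preim subQ (op x).
case: x subQx => i subQx /=; case: (bideg w) IHw => m' n' IHw [em en] /=;
  apply: (IHw (fun y => Q (op _ y)) m' n' subQx) => // I J sI sJ.
- by apply: (QEF (i :: I)) => //=; lia.
- by apply: h_span => I' J' sI' sJ'; apply: QEF; lia.
- by apply: f_span => // I' J' sI' sJ'; apply: QEF; lia.
Qed.

(* The coefficient of [x^i y^J] in [prod_b (x - y_b) * e(x) prod_b f(y_b) u], up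
   to a power of [x]. The factors [x - y_b] kill every commutator of [e(x)] with
   an [f(y_b)], which is supported on [x = y_b]. *)
Fixpoint cleared (J : seq int) (i : int) (u : V) : V :=
  if J is j :: J' then cleared J' i (f j u) - cleared J' (i + 1) (f (j - 1) u)
  else e i u.

(** The definition keeps [f j] to the right of [e]; here it comes out on the left. The brackets of
    [e i] with [f j] and of [e (i + 1)] with [f (j - 1)] are both [h (i + j)] and cancel. *)
Lemma cleared_cons j J i u :
  cleared (j :: J) i u = f j (cleared J i u) - f (j - 1) (cleared J (i + 1) u).
Proof.
have opACA (p q r s : V) : (p - q) - (r - s) = (p - r) - (q - s).
  by rewrite !opprD !opprK addrACA.
elim: J i u => [|a J IHJ] i u.
  rewrite /= !efC (_ : i + 1 + (j - 1) = i + j); last by rewrite addrACA subrr addr0.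
  by rewrite opprD addrACA subrr addr0.
rewrite [RHS]/= 2!(raddfB (op _)).
rewrite opACA -!IHJ /= opACA.
by rewrite (fC j a) (fC j (a - 1)) (fC (j - 1) a) (fC (j - 1) (a - 1)).
Qed.

(** With all f's pulled out, only letters [e] of index at most [i + size J] act on [v]. *)
Lemma cleared_vac J (i : int) : i + (size J)%:Z <= 0 -> cleared J i v = 0.
Proof.
elim: J i => [|j J IHJ] i iJ; first by apply: op_vac => /=; lia.
move: iJ => /= iJ.
rewrite -[LHS]/(cleared (j :: J) i v) cleared_cons !IHJ ?raddf0 ?addr0 //; lia.
Qed.

Definition isum (J : seq int) : int := \sum_(j <- J) j.

(** Each factor either leaves the indices alone or raises that of [e] and lowers that of one [f] by
    1. Only the term without shifts keeps the sum of [J]. *)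
Lemma cleared_lead (Q : V -> Prop) J i u : subgroup Q ->
  (forall J' i', size J' = size J -> isum J' < isum J -> Q (e i' (Fact J' u))) ->
  Q (cleared J i u - e i (Fact J u)).
Proof.
move=> subQ; rewrite /isum; elim: J i u => [|j J IHJ] i u QJ /=.
  by rewrite subrr; apply: subgroup0.
have -> : cleared J i (f j u) - cleared J (i + 1) (f (j - 1) u) - e i (f j (Fact J u))
    = (cleared J i (f j u) - e i (Fact J (f j u)))
      - ((cleared J (i + 1) (f (j - 1) u) - e (i + 1) (Fact J (f (j - 1) u)))
         + e (i + 1) (Fact (j - 1 :: J) u)).
  by rewrite /= -!fFact subrK addrAC.
apply: subgroupB => //; last apply: subgroupD => //.
- apply: IHJ => J' i' sJ' lJ'; rewrite -fFact; apply: (QJ (j :: J')) => /=.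
    by rewrite sJ'.
  by rewrite !big_cons ltrD2l.
- apply: IHJ => J' i' sJ' lJ'; rewrite -fFact; apply: (QJ (j - 1 :: J')) => /=.
    by rewrite sJ'.
  by rewrite !big_cons ltrD // gtrBl.
- by apply: QJ => //; rewrite !big_cons ltrD2r gtrBl.
Qed.

Lemma e_low_span (Q : V -> Prop) i J : subgroup Q -> i + (size J)%:Z <= 0 ->
  (forall J' i', size J' = size J -> isum J' < isum J -> Q (e i' (Fact J' v))) ->
  Q (e i (Fact J v)).
Proof.
move=> subQ iJ QJ; rewrite -[e i _]opprK; apply: (subgroupN subQ).
rewrite -sub0r -(cleared_vac iJ); exact: cleared_lead.
Qed.

(** * Consequences of the field relations *)

Section RelationsInW.

(* [R] stands for the kernel of M_H ->> W. *)
Variable R : V -> Prop.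
Hypothesis subR : subgroup R.
Hypothesis R_field : forall X Y w k s, List.In (X, Y) field_pairs ->
  fsum (fun i => op (X i) (op (Y (k - i)) (act w))) s -> R s.

(* Commuting e_i past f(z)^2 produces f(z)h(z), and past f(z)h(z) produces h(z)^2;
   both are again relations, so left multiplication by the e_i preserves [R]. *)
Lemma R_Eact_hh I w k s :
  fsum (fun j => h j (h (k - j) (act w))) s -> R (Eact I s).
Proof.
(* Peeling from the right lets the innermost [e i] be absorbed into the word [w]. *)
elim/last_ind: I w s => [|I i IHI] w s sE.
  by apply: (R_field (X := LH) (Y := LH)) sE => /=; tauto.
rewrite -cats1 Eact_cat; apply: (IHI (LE i :: w)).
by apply: eq_fsum (fsum_raddf (op (LE i)) sE) => j; rewrite /= !heC.
Qed.

Lemma EactD I x y : Eact I (x + y) = Eact I x + Eact I y.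
Proof. by elim: I => //= i I ->; rewrite raddfD. Qed.

Lemma R_Eact_fh I w k s :
  fsum (fun j => f j (h (k - j) (act w))) s -> R (Eact I s).
Proof.
elim/last_ind: I w s => [|I i IHI] w s sE.
  by apply: (R_field (X := LF) (Y := LH)) sE => /=; tauto.
have [s1 s1E] : exists s, fsum (fun j => f j (h (k - j) (act (LE i :: w)))) s.
  by apply: fsum_field => // j j' u; rewrite hfC.
have [s2 s2E] : exists s, fsum (fun j => h j (h (k + i - j) (act w))) s.
  by apply: fsum_field => // j j' u; rewrite hC.
(* The shift from [j] to [i + j] turns the terms of [s2] into the commutator terms
   [h (i + j) (h (k - j) _)]. *)
have s2E' := fsum_reindex (addKr i) (addNKr i) s2E.
have eE : e i s = s1 + s2.
  apply: fsum_uniq (fsum_raddf (op (LE i)) sE) _.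
  apply: eq_fsum (fsumD s1E s2E') => j.
  by rewrite /= efC heC; congr (_ + h _ (h _ _)); lia.
rewrite -cats1 Eact_cat /= eE EactD; apply: subgroupD => //.
  exact: IHI s1E.
exact: R_Eact_hh s2E.
Qed.

Lemma R_Eact_ff I w k s :
  fsum (fun j => f j (f (k - j) (act w))) s -> R (Eact I s).
Proof.
elim/last_ind: I w s => [|I i IHI] w s sE.
  by apply: (R_field (X := LF) (Y := LF)) sE => /=; tauto.
have [s1 s1E] : exists s, fsum (fun j => f j (f (k - j) (act (LE i :: w)))) s.
  by apply: fsum_field => // j j' u; rewrite fC.
have [s2 s2E] : exists s, fsum (fun j => f j (h (k + i - j) (act w))) s.
  by apply: fsum_field => // j j' u; rewrite hfC.
(* The two commutator terms, [f j] with [h (k + i - j)] and [f (k - j)] with [h (i + j)], are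
   exchanged by this reflection, so each sums to [s2]. *)
pose refl_k (j : int) := k - j.
have subK : cancel refl_k refl_k by rewrite /refl_k => j; lia.
have s2E' := fsum_reindex subK subK s2E.
have eE : e i s = s1 + s2 + s2.
  apply: fsum_uniq (fsum_raddf (op (LE i)) sE) _.
  apply: eq_fsum (fsumD (fsumD s1E s2E) s2E') => j.
  rewrite /= !efC raddfD hfC /= /refl_k; congr (_ + f _ (h _ _) + f _ (h _ _)); lia.
rewrite -cats1 Eact_cat /= eE !EactD; do 2?[apply: subgroupD => //].
- exact: IHI s1E.
- exact: R_Eact_fh s2E.
- exact: R_Eact_fh s2E.
Qed.

Variable Q : V -> Prop.
Hypothesis subQ : subgroup Q.
Hypothesis RQ : forall x, R x -> Q x.
(* In odd degree every product occurs twice in the coefficient of a square. *)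
Hypothesis half : forall x, Q (x + x) -> Q x.

(** As [p] and [k - p] are the middle indices, any other [i] has [i < p] or [k - i < p], and
    symmetry covers the second case. *)
Lemma spread_pair (g : int -> V) (k p : int) s :
  p <= k - p <= p + 1 -> (forall i, g (k - i) = g i) -> fsum g s -> R s ->
  (forall i, i < p -> Q (g i)) -> Q (g p).
Proof.
move=> pk gsym gs Rs Qg; apply: fsum_pair gs (RQ Rs) _ => // i ip ikp.
have [|pi] := ltP i p; first exact: Qg.
by rewrite -gsym; apply: Qg; lia.
Qed.

Lemma EF_span m n :
  (forall I J, size I = m -> size J = n ->
     sorted gap2 I -> all (fun i => 1 - n%:Z <= i) I ->
     sorted gap2 J -> all (fun j => 1 <= j) J -> Q (Eact I (Fact J v))) ->
  forall I J, size I = m -> size J = n -> Q (Eact I (Fact J v)).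
Proof.
move=> Qadm.
suff main (N : nat) J : size J = n -> isum J < N%:Z ->
    forall I, size I = m -> Q (Eact I (Fact J v)).
  by move=> I J sI sJ; apply: (main (absz (isum J)).+1) => //; lia.
elim: N J => [|N IHN].
  (* A negative sum forces an entry [<= 0], whose [f] kills [v]. *)
  move=> J _ J0 I _; suff /hasP[j jJ j0] : has (fun j => j <= 0) J.
    by rewrite (Fact_vac jJ j0) Eact0; apply: subgroup0.
  apply: contraTT J0 => /hasPn J0; rewrite -leNgt /isum big_seq.
  by apply: sumr_ge0 => j /J0; lia.
apply: (spread_ind (b := 1)).
- move=> s t st Ps ltN I sI; rewrite -(Fact_perm _ st); apply: Ps => //.
  by rewrite /isum (perm_big _ st).
- move=> s ss /hasP[j js j1] _ I _; rewrite (Fact_vac js); last by lia.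
  by rewrite Eact0; apply: subgroup0.
- move=> p k s ss pk IHp ltN I sI.
  have [s0 s0E] : exists s0,
      fsum (fun j => f j (f (k - j) (act [seq LF j | j <- s]))) s0.
    by apply: fsum_field => // j j' u; rewrite fC.
  have Rs0 := R_Eact_ff I s0E.
  have [g gE] := Eact_additive I.
  have as_ := act_EF [::] s; rewrite /= in as_.
  have gs := fsum_raddf g s0E; rewrite -gE as_ in gs.
  rewrite gE; apply: (spread_pair (g := fun p => g (f p (f (k - p) (Fact s v)))) pk _ gs Rs0).
    by move=> j; rewrite fC (_ : k - (k - j) = j) //; lia.
  move=> i ip; rewrite -gE; apply: (IHp i ip _ I sI).
  by move: ltN; rewrite /isum !big_cons; lia.
- move=> J sJ gJ J1 ltN.
  (* An entry [i < 1 - n] satisfies [i + size J <= 0], so [e_low_span] lowers the sum of [J] and the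
     outer induction applies. *)
  apply: (spread_ind (b := 1 - n%:Z)).
  + by move=> s t st; rewrite (Eact_perm _ st).
  + move=> s ss /hasP[i is_ i1]; rewrite (Eact_perm _ (perm_to_rem is_)) /= eEact.
    have [g gE] := Eact_additive (rem i s); rewrite gE.
    apply: (e_low_span (Q := fun x => Q (g x))); first exact: subgroup_preim.
      by rewrite sJ; lia.
    move=> J' i' sJ' ltJ'; rewrite -gE -eEact.
    apply: (IHN J' _ _ (i' :: rem i s)); rewrite ?sJ' //.
      by apply: lt_le_trans ltJ' _; rewrite -ltzD1 addrC -intS.
    by rewrite -ss (perm_size (perm_to_rem is_)).
  + move=> p k s ss pk IHp.
    (* The pair of e's stands in front of all other letters, so the relation for [e(z)^2] applies to
       this word directly. *)
    pose w := [seq LE i | i <- s] ++ [seq LF j | j <- J].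
    have [s0 s0E] : exists s0, fsum (fun i => e i (e (k - i) (act w))) s0.
      by apply: fsum_field => // j j' u; rewrite eC.
    have Rs0 : R s0 by apply: R_field s0E; left.
    rewrite act_EF in s0E.
    apply: (spread_pair (g := fun p => e p (e (k - p) (Eact s (Fact J v)))) pk _ s0E Rs0) IHp.
    by move=> j; rewrite eC (_ : k - (k - j) = j) //; lia.
  + by move=> I sI gI I1; apply: Qadm.
Qed.

End RelationsInW.

End InducedModule.

(** * From gap sequences to partitions *)

Lemma gap2_partition (s : seq int) (b : int) :
  sorted gap2 s -> all (fun x => b <= x) s ->
  exists al, partition_of (size s) al /\
    s = [seq (nth 0%N al j)%:Z + 2 * Posz (subn (size s) j.+1) + b
        | j <- iota 0 (size s)].
Proof.
elim: s => [|x s IHs]; first by exists [::].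
move=> gs /andP[bx bs]; have [al [[sal oal] sE]] := IHs (path_sorted gs) bs.
(* Subtracting the staircase turns gaps of at least 2 into weak decrease and the bound [b] into
   nonnegativity, so [absz] loses nothing. *)
exists (absz (x - 2 * (size s)%:Z - b)%R :: al).
have xE : absz (x - 2 * (size s)%:Z - b)%R = x - 2 * (size s)%:Z - b :> int
    /\ path geq (absz (x - 2 * (size s)%:Z - b)%R) al.
  case: s sE sal gs {IHs bs} => [|y s] sE sal /= gs.
    by case: al sal oal sE => //= _ _ _; split; lia.
  case: al sal oal sE => //= a al _ oal [yE _].
  by move/andP: gs => [xy _]; move: xy; rewrite /gap2 yE => xy; rewrite oal andbT /geq; split; lia.
case: xE => xE oal'; split; first by split=> //=; rewrite sal.
rewrite /= subn1 xE; congr (_ :: _); first by lia.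
by rewrite {1}sE -[1%N]addn0 iotaDl -map_comp; apply: eq_map.
Qed.

(** * Left multiplication on the tensor algebra *)

Lemma mulwE (a : word) (x : T) (d : {fset word}) : (msupp x `<=` d)%fset ->
  mulw a x = \sum_(w <- d) << x@_w *g (a ++ w) >>.
Proof.
move=> xd; rewrite /mulw (big_fset_incl _ xd) // => w _ /mcoeff_outdom ->.
by rewrite monalgU0.
Qed.

Lemma mulw_is_linear a : linear (mulw a).
Proof.
(* A common set of words containing all three supports makes linearity a termwise identity. *)
move=> c x y; set d := (msupp x `|` msupp y)%fset.
have xd : (msupp x `<=` d)%fset by apply: fsubsetUl.
have yd : (msupp y `<=` d)%fset by apply: fsubsetUr.
have cd : (msupp (c *: x + y) `<=` d)%fset.
  apply: fsubset_trans (msuppD_le _ _) _; rewrite fsubUset yd andbT.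
  exact: fsubset_trans (msuppZ_le _ _) xd.
rewrite (mulwE _ cd) (mulwE _ xd) (mulwE _ yd) scaler_sumr -big_split /=.
apply: eq_bigr => w _; apply/malgP => k.
by rewrite !(mcoeffD, mcoeffZ, mcoeffU) mulrnAr mulrnDl.
Qed.

HB.instance Definition _ a :=
  GRing.isLinear.Build _ _ _ _ (mulw a) (mulw_is_linear a).

Lemma mulw_wvec a w : mulw a (wvec w) = wvec (a ++ w).
Proof.
by rewrite /mulw /wvec msuppU oner_eq0 big_seq_fset1 mcoeffUU.
Qed.

Lemma malgU_wvec (c : C) w : << c *g w >> = c *: wvec w :> T.
Proof. by apply/malgP => k; rewrite mcoeffZ !mcoeffU mulrnAr mulr1. Qed.

Lemma mulw_sum a (t : T) : mulw a t = \sum_(w <- msupp t) t@_w *: wvec (a ++ w).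
Proof. by apply: eq_bigr => w _; apply: malgU_wvec. Qed.

Lemma wvec_sum (t : T) : t = \sum_(w <- msupp t) t@_w *: wvec w.
Proof. by rewrite {1}[t]monalgE; apply: eq_bigr => w _; apply: malgU_wvec. Qed.

Lemma mulw_cat a b x : mulw a (mulw b x) = mulw (a ++ b) x.
Proof.
rewrite (mulw_sum b) (mulw_sum (a ++ b)) raddf_sum /=; apply: eq_bigr => w _.
by rewrite linearZ /= mulw_wvec catA.
Qed.

(** * The quotient $M_{\mathcal H}$ and its operators *)

Lemma spanN (P : T -> Prop) t : span_of P t -> span_of P (- t).
Proof. by move=> Pt; rewrite -scaleN1r; apply: spanZ. Qed.

Lemma span_of_mono (P P' : T -> Prop) t :
  (forall s, P s -> span_of P' s) -> span_of P t -> span_of P' t.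
Proof.
move=> PP'; elim=> [|x y _ Px _ Py|c x _ Px|x /PP' //].
- exact: span0.
- exact: spanD.
- exact: spanZ.
Qed.

(** Both kinds of generators carry an arbitrary left word, which absorbs [l]. *)
Lemma zero_in_MH_mulw l t : zero_in_MH t -> zero_in_MH (mulw [:: l] t).
Proof.
elim=> [|x y _ Px _ Py|c x _ Px|x].
- by rewrite raddf0; apply: span0.
- by rewrite raddfD; apply: spanD.
- by rewrite linearZ; apply: spanZ.
case=> [[a [b [y [z ->]]]]|[a [z [z0 ->]]]]; apply: span_gen; last first.
  by right; exists (l :: a), z; rewrite mulw_wvec.
left; exists (l :: a), b, y, z; rewrite !raddfB /= !mulw_wvec.
by congr (_ - _ - _); case: y z => i [] j /=; rewrite ?raddf0 ?raddfN /= ?mulw_wvec.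
Qed.

Definition MHker : {pred T} := fun t => `[< zero_in_MH t >].

Lemma MHker_zmod_closed : zmod_closed MHker.
Proof.
split=> [|x y /asboolP Px /asboolP Py]; apply/asboolP; first exact: span0.
by apply: spanD => //; apply: spanN.
Qed.

HB.instance Definition _ := GRing.isZmodClosed.Build T MHker MHker_zmod_closed.

(** Only the additive structure is kept; in the abstract argument scalars enter solely as division
    by 2, through [half]. *)
Definition MH : zmodType := Quotient.quot MHker.

Definition toMH (t : T) : MH := \pi_(Quotient.quot MHker)%qT t.

HB.instance Definition _ := GRing.isZmodMorphism.Build T MH toMH
  (@pi_is_zmod_morphism _ _ _ (Quotient.quot MHker)).

Lemma toMH_surj (x : MH) : exists t, toMH t = x.
Proof. by exists (repr x); apply: reprK. Qed.

Lemma toMH_eq0 t : toMH t = 0 <-> zero_in_MH t.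
Proof.
have := Quotient.idealrBE MHker t 0; rewrite subr0 -!/(toMH _) raddf0 => E.
split=> [/eqP|t0]; first by rewrite -[_ == _]E => /asboolP.
by apply/eqP; rewrite -[_ == _]E; apply/asboolP.
Qed.

(** Acts on a chosen representative; [opMHE] shows that the choice does not matter. *)
Definition opMH (l : letter) (x : MH) : MH := toMH (mulw [:: l] (repr x)).

Lemma opMHE l t : opMH l (toMH t) = toMH (mulw [:: l] t).
Proof.
apply/eqP; rewrite -subr_eq0 -!raddfB; apply/eqP/toMH_eq0/zero_in_MH_mulw/toMH_eq0.
by rewrite raddfB; apply/eqP; rewrite subr_eq0; apply/eqP; apply: reprK.
Qed.

Lemma opMH_zmod_morphism l : zmod_morphism (opMH l).
Proof.
move=> x y; have [t <-] := toMH_surj x; have [s <-] := toMH_surj y.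
by rewrite -raddfB !opMHE !raddfB.
Qed.

HB.instance Definition _ l :=
  GRing.isZmodMorphism.Build MH MH (opMH l) (opMH_zmod_morphism l).

Definition opM (l : letter) : {additive MH -> MH} := opMH l.

Lemma opME l t : opM l (toMH t) = toMH (mulw [:: l] t).
Proof. exact: opMHE. Qed.

Lemma act_opM w : act opM (toMH (wvec [::])) w = toMH (wvec w).
Proof. by elim: w => //= l w ->; rewrite opME mulw_wvec. Qed.

Lemma opMC x y u : opM x (opM y u) = opM y (opM x u) + bracket_op opM x y u.
Proof.
have [t <-] := toMH_surj u.
have -> : bracket_op opM x y (toMH t)
    = toMH (\sum_(w <- msupp t) t@_w *: bracket_term [::] w x y).
  have op_sum l : opM l (toMH t)
      = toMH (\sum_(w <- msupp t) t@_w *: wvec (l :: w)).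
    by rewrite opME mulw_sum.
  case: x y => i [] j /=; rewrite ?op_sum //;
    try by [rewrite big1 ?raddf0 // => w _; rewrite scaler0].
  by rewrite -raddfN -sumrN /=; under [in RHS]eq_bigr do rewrite scalerN.
apply/eqP; rewrite -subr_eq0 opprD addrA !opME -!raddfB !mulw_cat !mulw_sum.
rewrite -!sumrB; apply/eqP/toMH_eq0.
(* Word by word, the difference is a multiple of a commutation generator with empty left word. *)
apply: (big_ind zero_in_MH) => [|a b|w _]; [exact: span0|exact: spanD|].
rewrite -!scalerBr; apply: spanZ; apply: span_gen; left.
by exists [::], w, x, y.
Qed.

Lemma opM_vac l : lidx l <= 0 -> opM l (toMH (wvec [::])) = 0.
Proof.
move=> l0; rewrite opME mulw_wvec; apply/toMH_eq0; apply: span_gen; right.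
by exists [::], l.
Qed.

(** * The kernel of the map from $M_{\mathcal H}$ to $W$ *)

Lemma zero_in_MHW t : zero_in_MH t -> zero_in_W t.
Proof. by apply: span_of_mono => s s0; apply: span_gen; left. Qed.

(* The kernel of M_H ->> W. *)
Definition W0 (x : MH) : Prop := exists2 t, toMH t = x & zero_in_W t.

Lemma W0_subgroup : subgroup W0.
Proof.
split=> [|_ _ [s <- s0] [t <- t0]]; first by exists 0; rewrite ?raddf0 //; apply: span0.
by exists (s - t); rewrite ?raddfB //; apply: spanD => //; apply: spanN.
Qed.

Lemma W0_field X Y w k s : List.In (X, Y) field_pairs ->
  fsum (fun i => opM (X i) (opM (Y (k - i)) (act opM (toMH (wvec [::])) w))) s ->
  W0 s.
Proof.
move=> XY [S [uS gS ->]].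
have opE i : opM (X i) (opM (Y (k - i)) (act opM (toMH (wvec [::])) w))
    = toMH (mulw [:: X i; Y (k - i)] (wvec w)).
  by rewrite act_opM !opME mulw_cat.
exists (\sum_(i <- S) mulw [:: X i; Y (k - i)] (wvec w)).
  by rewrite raddf_sum; apply: eq_bigr => i _; rewrite opE.
(* Vanishing in [MH] outside [S] is exactly the finiteness condition in [W_rel]. *)
apply: span_gen; right; exists X, Y, (wvec w), k, S; split=> // i /gS.
by rewrite opE => /toMH_eq0.
Qed.

(** * Spanning of $W_{m,n}$ *)

Definition spanned (m n : nat) (t : T) : Prop :=
  exists s : seq (C * seq nat * seq nat),
    (forall p, p \in s -> partition_of m p.1.2 /\ partition_of n p.2) /\
    zero_in_W (t - \sum_(p <- s) p.1.1 *: v_ab m n p.1.2 p.2).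

Lemma C2_neq0 : (2%:R : C) != 0.
Proof. by have := @pnatr_eq0 (Rdefinitions.R)[i]%C 2; rewrite -/C => ->. Qed.

Lemma spanned_zero m n t : zero_in_W t -> spanned m n t.
Proof. by move=> t0; exists [::]; rewrite big_nil subr0. Qed.

Lemma spannedD m n t u : spanned m n t -> spanned m n u -> spanned m n (t + u).
Proof.
case=> [s [sP s0]] [r [rP r0]]; exists (s ++ r); split.
  by move=> p; rewrite mem_cat => /orP[/sP|/rP].
by rewrite big_cat /= opprD addrACA; apply: spanD.
Qed.

Lemma spannedZ m n c t : spanned m n t -> spanned m n (c *: t).
Proof.
case=> [s [sP s0]]; exists [seq (c * p.1.1, p.1.2, p.2) | p <- s]; split.
  by move=> _ /mapP[p ps ->]; exact: (sP p ps).
rewrite big_map /=; under eq_bigr do rewrite -scalerA.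
by rewrite -scaler_sumr -scalerBr; apply: spanZ.
Qed.

Lemma spanned_vword m n al be : partition_of m al -> partition_of n be ->
  spanned m n (v_ab m n al be).
Proof.
move=> pa pb; exists [:: (1, al, be)]; split; first by move=> p; rewrite inE => /eqP ->.
by rewrite big_seq1 scale1r subrr; apply: span0.
Qed.

Lemma spanned_word m n w : bideg w = (m, n) -> spanned m n (wvec w).
Proof.
pose Q x := exists2 t, toMH t = x & spanned m n t.
(* Two lifts of one vector of [MH] differ by an element that is zero in [MH], hence zero in $W$. *)
have Q_toMH t : Q (toMH t) -> spanned m n t.
  case=> s st sS; rewrite -[t](subrK s); apply: spannedD => //.
  apply/spanned_zero/zero_in_MHW/toMH_eq0.
  by rewrite raddfB /= st subrr.
have subQ : subgroup Q.
  split=> [|_ _ [s <- sS] [t <- tS]].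
    by exists 0; rewrite ?raddf0 //; apply/spanned_zero/span0.
  exists (s - t); rewrite ?raddfB // -scaleN1r.
  by apply: spannedD => //; apply: spannedZ.
have half x : Q (x + x) -> Q x.
  have [t <-] := toMH_surj x; rewrite -raddfD => /Q_toMH tS.
  exists t => //; have -> : t = (2%:R^-1 : C) *: (t + t).
    by rewrite -{2 3}[t]scale1r -scalerDl scalerA mulVf ?scale1r ?C2_neq0.
  exact: spannedZ.
move=> bw; apply: Q_toMH; rewrite -act_opM.
apply: (act_span opMC opM_vac subQ _ bw).
apply: (EF_span opMC opM_vac W0_subgroup W0_field subQ) => //.
  by move=> x [t <- t0]; exists t => //; apply: spanned_zero.
move=> I J sI sJ gI I1 gJ J1; rewrite -act_EF act_opM.
(* The lower bounds [1 - n] and [1] are the constant terms of the indices in [vword]. *)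
have [al [pal IE]] := gap2_partition gI I1.
have [be [pbe JE]] := gap2_partition gJ J1.
rewrite sI in pal IE; rewrite sJ in pbe JE.
exists (v_ab m n al be); last exact: spanned_vword.
rewrite /v_ab /vword IE JE -!map_comp.
congr (toMH (wvec (_ ++ _))); apply: eq_map => j //=.
by rewrite addrA.
Qed.

Lemma bideg_cat a b :
  bideg (a ++ b) = ((bideg a).1 + (bideg b).1, (bideg a).2 + (bideg b).2)%N.
Proof.
elim: a => [|x a IHa] /=; first by case: (bideg b).
by rewrite IHa /=; congr (_, _); lia.
Qed.

Lemma bideg_vword m n al be : bideg (vword m n al be) = (m, n).
Proof.
have bE (F : nat -> int) s : bideg [seq LE (F j) | j <- s] = (size s, 0%N).
  by elim: s => //= j s ->.
have bF (F : nat -> int) s : bideg [seq LF (F j) | j <- s] = (0%N, size s).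
  by elim: s => //= j s ->.
by rewrite bideg_cat bE bF !size_iota addn0.
Qed.

Unset Implicit Arguments.

(* W_{m,n} (= image of T_{m,n} in W) is spanned by the v_{alpha,beta}. *)
Theorem theorem4p1p1 (m n : nat) :
  (forall al be : seq nat, partition_of m al -> partition_of n be ->
     homog m n (v_ab m n al be)) /\
  (forall t : T, homog m n t ->
     exists s : seq (C * seq nat * seq nat),
       (forall p, p \in s -> partition_of m p.1.2 /\ partition_of n p.2) /\
       zero_in_W (t - \sum_(p <- s) p.1.1 *: v_ab m n p.1.2 p.2)).
Proof.
split=> [al be _ _ w|t ht].
  by rewrite /v_ab /wvec msuppU oner_eq0 inE => /eqP ->; apply: bideg_vword.
(* [big_seq] records that each word lies in the support of [t], which gives its bidegree. *)
rewrite -/(spanned m n t) (wvec_sum t) big_seq.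
apply: (big_ind (spanned m n)) => [|x y|w wt].
- exact/spanned_zero/span0.
- exact: spannedD.
- exact/spannedZ/spanned_word/ht.
Qed.
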